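(* Let $(X,+)$, $(Y,+)$ be abelian Polish groups, and let $(\mathcal{A},\mathcal{I})$ and $(\mathcal{B},\mathcal{J})$ be pairs on $X$ and $Y$ respectively, either both consisting of an algebra and an ideal, or both consisting of a $\sigma$-algebra and a $\sigma$-ideal, where the ideals contain all singletons, every member of $\mathcal{I}$ is contained in a member of $\mathcal{A}\cap\mathcal{I}$, and every member of $\mathcal{J}$ is contained in a member of $\mathcal{B}\cap\mathcal{J}$. If $(\mathcal{A}\otimes\mathcal{B},\mathcal{I}\otimes\mathcal{J})$ has SP (respectively WSP, VWSP), then $(\mathcal{A},\mathcal{I})$ and $(\mathcal{B},\mathcal{J})$ also have SP (respectively WSP, VWSP).
   Context: $\mathcal{A}\otimes\mathcal{B}$ is the algebra (respectively $\sigma$-algebra, in the $\sigma$-case) on $X\times Y$ generated by the rectangles $A\times B$ with $A\in\mathcal{A}$, $B\in\mathcal{B}$. For $C\subseteq X\times Y$ and $x\in X$, $C_x=\{y\in Y:(x,y)\in C\}$. Fubini product: $K\in\mathcal{I}\otimes\mathcal{J}$ iff there is $C\in\mathcal{A}\otimes\mathcal{B}$ with $K\subseteq C$ and $\{x\in X:C_x\notin\mathcal{J}\}\in\mathcal{I}$. For a pair $(\mathcal{S},\mathcal{K})$ of a ($\sigma$-)algebra and a ($\sigma$-)ideal on an abelian Polish group $Z$, a set is $\mathcal{K}$-residual if its complement is in $\mathcal{K}$, $A+D=\{a+d:a\in A,d\in D\}$, and: - SP (Smital Property): for every dense set $D\subseteq Z$ and every $A\in\mathcal{S}\setminus\mathcal{K}$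 the set $A+D$ is $\mathcal{K}$-residual; - WSP (Weaker Smital Property): there exists a countable dense set $D\subseteq Z$ such that for every $A\in\mathcal{S}\setminus\mathcal{K}$ the set $A+D$ is $\mathcal{K}$-residual; - VWSP (Very Weak Smital Property): for every $A\in\mathcal{S}\setminus\mathcal{K}$ there is a countable set $D\subseteq Z$ such that $A+D$ is $\mathcal{K}$-residual. *)

(* Defs.v *)
From HB Require Import structures.
From mathcomp Require Import all_boot all_order all_algebra.
From mathcomp Require Import all_classical all_reals all_analysis.
Set Implicit Arguments.
Unset Strict Implicit.
Unset Printing Implicit Defensive.
Import Order.TTheory GRing.Theory Num.Theory.
Import numFieldNormedType.Exports.
Local Open Scope classical_set_scope.
Local Open Scope ring_scope.

(* The direct product group with the product topology. The alias is needed
   because the library's joint topological/group instances on [prod] cover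
   topological vector spaces only. *)
Definition prod_group (X Y : topologicalZmodType) : Type := (X * Y)%type.

Section prod_group.
Variables X Y : topologicalZmodType.

HB.instance Definition _ := Topological.copy (prod_group X Y) (X * Y)%type.
HB.instance Definition _ := GRing.Zmodule.copy (prod_group X Y) (X * Y)%type.

Let prod_sub_continuous :
  continuous (fun z : prod_group X Y * prod_group X Y => z.1 - z.2).
Proof.
move=> z.
suff h : (fun w : (X * Y) * (X * Y) => (w.1.1 - w.2.1, w.1.2 - w.2.2)) @ z
    --> (z.1.1 - z.2.1, z.1.2 - z.2.2) by exact: h.
apply: cvg_pair => /=.
- apply: (@continuous_comp _ _ _ (fun w : (X * Y) * (X * Y) => (w.1.1, w.2.1))
    (fun p : X * X => p.1 - p.2)); last exact: sub_continuous.
  by apply: cvg_pair; apply: continuous_comp;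
    [exact: cvg_fst|exact: cvg_fst|exact: cvg_snd|exact: cvg_fst].
- apply: (@continuous_comp _ _ _ (fun w : (X * Y) * (X * Y) => (w.1.2, w.2.2))
    (fun p : Y * Y => p.1 - p.2)); last exact: sub_continuous.
  by apply: cvg_pair; apply: continuous_comp;
    [exact: cvg_fst|exact: cvg_snd|exact: cvg_snd|exact: cvg_snd].
Qed.

HB.instance Definition _ := PreTopologicalNmodule_isTopologicalZmodule.Build
  (prod_group X Y) prod_sub_continuous.

End prod_group.

Section polish.
Variables (R : realType) (T : topologicalType).

Definition separable := exists2 D : set T, countable D & dense D.

(* [d] need not be translation invariant. *)
Definition completely_metrizable := exists d : T -> T -> R,
  [/\ [/\ forall x y, d x y = 0 <-> x = y,
          forall x y, d x y = d y x &
          forall x y z, d x z <= d x y + d y z],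
      forall x (U : set T),
        nbhs x U <-> exists2 e : R, 0 < e & [set y | d x y < e] `<=` U &
      forall u : nat -> T,
        (forall e : R, 0 < e -> \forall m & n \near \oo, d (u m) (u n) < e) ->
        exists l : T, u @ \oo --> l].

Definition polish := separable /\ completely_metrizable.

End polish.

Section set_systems.
Variable T : Type.
Implicit Types S K : set (set T).

Definition set_algebra S := [/\ S set0, setC_closed S & setU_closed S].

(* Ideals are proper. *)
Definition set_ideal K :=
  [/\ K set0, ~ K setT, forall A B, A `<=` B -> K B -> K A & setU_closed K].

Definition sigma_ideal K := set_ideal K /\
  forall F : (set T)^nat, (forall n, K (F n)) -> K (\bigcup_n F n).

(* The boolean selects between the finitely additive case ([false]) and the
   sigma-case ([true]). *)
Definition is_algebra (sigma : bool) : set (set T) -> Prop :=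
  if sigma then sigma_algebra setT else set_algebra.

Definition is_ideal (sigma : bool) : set (set T) -> Prop :=
  if sigma then sigma_ideal else set_ideal.

Definition residual K A := K (~` A).

End set_systems.

Section products.
Variables X Y : Type.

Definition prod_algebra (sigma : bool) (A : set (set X)) (B : set (set Y)) :
    set (set (X * Y)) :=
  smallest (@is_algebra (X * Y) sigma) [set P `*` Q | P in A & Q in B].

Definition fubini_product (sigma : bool) (A I : set (set X))
    (B J : set (set Y)) : set (set (X * Y)) :=
  [set K | exists2 C, prod_algebra sigma A B C &
     K `<=` C /\ I [set x | ~ J (xsection C x)]].

End products.

Section smital.
Variable Z : topologicalZmodType.
Implicit Types (S K : set (set Z)) (A D : set Z).

Definition sumset A D : set Z := [set a + d | a in A & d in D].

Definition SP S K := forall D, dense D -> forall A, (S `\` K) A ->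
  residual K (sumset A D).

Definition WSP S K := exists D, [/\ countable D, dense D &
  forall A, (S `\` K) A -> residual K (sumset A D)].

Definition VWSP S K := forall A, (S `\` K) A ->
  exists2 D, countable D & residual K (sumset A D).

End smital.

(* Main.v *)
Require Import Defs.
From mathcomp Require Import all_boot all_order all_algebra.
From mathcomp Require Import all_classical all_reals all_analysis.
Set Implicit Arguments.
Unset Strict Implicit.
Unset Printing Implicit Defensive.
Local Open Scope classical_set_scope.

(** The Smital properties descend along the two coordinate projections. Let
    [f : Z -> W] be a continuous open surjective group morphism. Then
    [f^-1(P) + D = f^-1(P + f(D))] for all [P] and [D]
    ([sumset_preimage]), so an instance of a Smital property on [Z] for a
    cylinder [f^-1(P)] is a statement about [P + f(D)] on [W]. Countability and
    density pass from [D] to [f(D)], and every dense [D] of [W] is the image of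
    the dense set [f^-1(D)]. Hence all three properties pass from a pair
    [(S, K)] on [Z] to a pair [(A, I)] on [W] as soon as cylinders over members
    of [A] are in [S] and a cylinder in [K] has its base in [I]
    ([smital_pushforward]).

    For the projections the first condition holds because a cylinder is a
    rectangle. The second one rests on properness of the ideals: that of [J]
    for the projection to [X] ([fubini_product_fst]), that of [I] for the
    projection to [Y] ([fubini_product_snd]). *)

(** The difference [z - d] serves as the first summand: whether it lies in
    [f^-1(P)] depends only on [f z - f d], so adding [D] to a cylinder only
    sees the image of [D]. *)
Lemma sumset_preimage (Z W : topologicalZmodType) (f : Z -> W)
    (fD : {morph f : x y / (x + y)%R}) (P : set W) (D : set Z) :
  sumset (f @^-1` P) D = f @^-1` sumset P (f @` D).
Proof.
apply/seteqP; split=> [z [p Pp [d Dd <-]]|z [p Pp [_ [d Dd <-] pfd]]].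
  by exists (f p) => //; exists (f d); [exists d|rewrite fD].
exists (z - d)%R; last by exists d => //; rewrite GRing.subrK.
rewrite /=; suff <- : p = f (z - d)%R by [].
by apply: (@GRing.addIr _ (f d)); rewrite -fD GRing.subrK.
Qed.

Lemma dense_image (T U : topologicalType) (f : T -> U) (D : set T) :
  continuous f -> range f = setT -> dense D -> dense (f @` D).
Proof.
move=> /continuousP fc fT dD O [u Ou] oO.
have [t _ ftu] : range f u by rewrite fT.
have [|s [Ofs Ds]] := dD (f @^-1` O) _ (fc O oO); first by exists t; rewrite /= ftu.
by exists (f s); split=> //; exists s.
Qed.

Lemma dense_preimage (T U : topologicalType) (f : T -> U) (D : set U) :
  (forall O, open O -> open (f @` O)) -> dense D -> dense (f @^-1` D).
Proof.
move=> fo dD O [t Ot] oO.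
have [|_ [[s Os <-] Ds]] := dD (f @` O) _ (fo O oO); first by exists (f t), t.
by exists s.
Qed.

(** The condition relating [K] to [I] is used twice: contraposed, it makes the
    cylinder over a set outside [I] lie outside [K]; applied to a complement,
    it makes the base of a residual cylinder residual. *)
Lemma smital_pushforward (Z W : topologicalZmodType) (f : Z -> W)
    (S K : set (set Z)) (A I : set (set W)) :
  {morph f : x y / (x + y)%R} -> continuous f ->
  (forall O, open O -> open (f @` O)) -> range f = setT ->
  (forall P, A P -> S (f @^-1` P)) -> (forall E, K (f @^-1` E) -> I E) ->
  [/\ SP S K -> SP A I, WSP S K -> WSP A I & VWSP S K -> VWSP A I].
Proof.
move=> fD fc fo fT AS KI.
have cylinder P : (A `\` I) P -> (S `\` K) (f @^-1` P).
  by case=> /AS SP nIP; split=> // /KI.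
have base P D : residual K (sumset (f @^-1` P) D) ->
    residual I (sumset P (f @` D)).
  by rewrite sumset_preimage// /residual preimage_setC => /KI.
split.
- move=> sp D dD P AP; rewrite -(image_preimage D fT); apply: base.
  by apply: sp; [exact: dense_preimage|exact: cylinder].
- move=> [D [cD dD wsp]]; exists (f @` D); split.
  + exact: sub_countable (card_image_le _ _) cD.
  + exact: dense_image.
  + by move=> P /cylinder /wsp; exact: base.
- move=> vwsp P /cylinder /vwsp[D cD PD]; exists (f @` D); last exact: base.
  exact: sub_countable (card_image_le _ _) cD.
Qed.

Lemma open_image_snd (T U : topologicalType) (O : set (T * U)) :
  open O -> open (snd @` O).
Proof.
rewrite !openE => oO _ [[t u] /= Otu <-].
have [[P Q] /= [Pt Qu] PQO] := oO _ Otu.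
apply: filterS Qu => v Qv; exists (t, v) => //; apply: PQO; split=> //=.
exact: nbhs_singleton Pt.
Qed.

Lemma is_algebraT (T : Type) (sigma : bool) (S : set (set T)) :
  is_algebra sigma S -> S setT.
Proof.
case: sigma => -[S0 SC _].
  by rewrite -(setD0 setT); exact: SC.
by rewrite -setC0; exact: SC.
Qed.

Lemma is_ideal_set_ideal (T : Type) (sigma : bool) (K : set (set T)) :
  is_ideal sigma K -> set_ideal K.
Proof. by case: sigma => // -[]. Qed.

Section cylinders.
Variables (X Y : Type) (sigma : bool).
Variables (A I : set (set X)) (B J : set (set Y)).

Lemma prod_algebra_rect (P : set X) (Q : set Y) :
  A P -> B Q -> prod_algebra sigma A B (P `*` Q).
Proof.
by move=> AP BQ; apply: sub_gen_smallest; exists P => //; exists Q.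
Qed.

(** The exceptional set of any cover contains [E], because [J] is proper. *)
Lemma fubini_product_fst (E : set X) : set_ideal I -> set_ideal J ->
  fubini_product sigma A I B J (fst @^-1` E) -> I E.
Proof.
move=> [_ _ Isub _] [_ JT _ _] [C _ [EC IC]]; apply: Isub IC => x Ex /= JC.
apply: JT; suff <- : xsection C x = setT by [].
by apply/seteqP; split=> // y _; rewrite /xsection /=; apply/mem_set/EC.
Qed.

(** Some point of [X] is not exceptional, because [I] is proper; the section of
    the cover there is a member of [J] containing [E]. *)
Lemma fubini_product_snd (E : set Y) : set_ideal I -> set_ideal J ->
  fubini_product sigma A I B J (snd @^-1` E) -> J E.
Proof.
move=> [_ IT _ _] [_ _ Jsub _] [C _ [EC IC]].
have [x JCx] : exists x, J (xsection C x).
  apply: contrapT => /forallNP nJC; apply: IT.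
  rewrite (_ : setT = [set x | ~ J (xsection C x)])//.
  by apply/seteqP; split=> // x _; exact: nJC.
by apply: Jsub JCx => y Ey; rewrite /xsection /=; apply/mem_set/EC.
Qed.

End cylinders.

Theorem proposition4 (R : realType) (X Y : topologicalZmodType)
  (polX : polish R X) (polY : polish R Y) (sigma : bool)
  (A I : set (set X)) (B J : set (set Y))
  (algA : is_algebra sigma A) (idI : is_ideal sigma I)
  (algB : is_algebra sigma B) (idJ : is_ideal sigma J)
  (I1 : forall x, I [set x]) (J1 : forall y, J [set y])
  (baseI : forall K, I K -> exists2 C, (A `&` I) C & K `<=` C)
  (baseJ : forall K, J K -> exists2 C, (B `&` J) C & K `<=` C) :
  let AB : set (set (prod_group X Y)) := prod_algebra sigma A B in
  let IJ : set (set (prod_group X Y)) := fubini_product sigma A I B J in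
  [/\ SP AB IJ -> SP A I /\ SP B J,
      WSP AB IJ -> WSP A I /\ WSP B J &
      VWSP AB IJ -> VWSP A I /\ VWSP B J].
Proof.
move=> AB IJ.
have propI := is_ideal_set_ideal idI; have propJ := is_ideal_set_ideal idJ.
have [spA wspA vwspA] : [/\ SP AB IJ -> SP A I, WSP AB IJ -> WSP A I &
    VWSP AB IJ -> VWSP A I].
  apply: (@smital_pushforward (prod_group X Y) X fst) => //.
  - by move=> z; exact: cvg_fst.
  - exact: (@fst_open X Y).
  - by apply/seteqP; split=> // x _; exists (x, 0%R).
  - move=> P AP; rewrite (_ : _ @^-1` _ = P `*` setT); last first.
      by apply/seteqP; split=> z // -[].
    exact: prod_algebra_rect AP (is_algebraT algB).
  - by move=> E; exact: fubini_product_fst.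
have [spB wspB vwspB] : [/\ SP AB IJ -> SP B J, WSP AB IJ -> WSP B J &
    VWSP AB IJ -> VWSP B J].
  apply: (@smital_pushforward (prod_group X Y) Y snd) => //.
  - by move=> z; exact: cvg_snd.
  - exact: (@open_image_snd X Y).
  - by apply/seteqP; split=> // y _; exists (0%R, y).
  - move=> Q BQ; rewrite (_ : _ @^-1` _ = setT `*` Q); last first.
      by apply/seteqP; split=> z // -[].
    exact: prod_algebra_rect (is_algebraT algA) BQ.
  - by move=> E; exact: fubini_product_snd.
by split=> h; split; [exact: spA|exact: spB|exact: wspA|exact: wspB|
  exact: vwspA|exact: vwspB].
Qed.
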